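(* Let $0<a<M$ and let $\mathcal{M}=\mathbb{R}_t\times(r_0,+\infty)\times\mathbb{S}^2$, $r_0=M+\sqrt{M^2-a^2}$, be the exterior of the subextremal Kerr black hole with mass $M$ and angular momentum per unit mass $a$. Let $\mathcal{N}_{0,r}\to\mathcal{M}$ be the $U(1)$ principal bundle defined in the context, and $\mathfrak{O}_{\mathbb{S}^2}$ the bundle of oriented orthonormal frames of $\mathbb{S}^2$. Define $$f:\mathbb{R}_t\times(r_0,+\infty)\times\mathfrak{O}_{\mathbb{S}^2}\to T_{\mathbb{C}}\mathcal{M},\qquad \big(t,r,(X,Y)\in(\mathfrak{O}_{\mathbb{S}^2})_\omega\big)\mapsto-\frac{ia\langle X+iY,e_3\rangle_{\mathbb{R}^3}}{\sqrt2\,p}\partial_t+\frac{1}{\sqrt2\,p}X+\frac{i}{\sqrt2\,p}Y\in T_{\mathbb{C},(t,r,\omega)}\mathcal{M},$$ where $p=r+ia\cos\theta$. Then $f$ takes its values in $\mathcal{N}_{0,r}$ and $f:\mathbb{R}_t\times(r_0,+\infty)\times\mathfrak{O}_{\mathbb{S}^2}\to\mathcal{N}_{0,r}$ is an isomorphism of ($U(1)$) principal bundles.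
   Context: The Kerr metric on $\mathcal{M}$ (signature $(+,-,-,-)$, $(\theta,\phi)$ spherical coordinates on $\mathbb{S}^2$) is $$g=\left(1-\tfrac{2Mr}{\rho^2}\right)dt^2+\tfrac{4Mar\sin^2\theta}{\rho^2}dt\,d\phi-\tfrac{\rho^2}{\Delta_r}dr^2-\rho^2d\theta^2-\sin^2\theta\left(r^2+a^2+\tfrac{2Ma^2r\sin^2\theta}{\rho^2}\right)d\phi^2,$$ with $\Delta_r=r^2-2Mr+a^2$, $\rho^2=r^2+a^2\cos^2\theta$; it extends smoothly across the poles. It is Ricci-flat of Petrov type D, and the following global smooth vector fields are null, independent, and span the two principal null directions: $$l=\tfrac{r^2+a^2}{\Delta_r}\partial_t+\partial_r+\tfrac{a}{\Delta_r}\partial_\phi,\qquad n=\tfrac{r^2+a^2}{2\rho^2}\partial_t-\tfrac{\Delta_r}{2\rho^2}\partial_r+\tfrac{a}{2\rho^2}\partial_\phi .$$ The time orientation is such that $l,n$ are future oriented, and the space orientation is the one for which $(\partial_\theta,-\partial_\phi,\partial_r)$ is positively oriented away from the axis. $g$ is extended $\mathbb{C}$-bilinearly to $T_{\mathbb{C}}\mathcal{M}$. $\mathcal{N}_{0,r}$ is the bundle of oriented Newman–Penrose null tetrads $(l',n',m)$ with $l'\in\mathbb{R}_+^*l$, $n'\in\mathbb{R}_+^*n$, modulo positive rescalings $(l',n',m)\mapsto(\lambda l',\lambda^{-1}n',m)$; it is identified with $$\mathcal{N}_{0,r}=\{m\in T_{\mathbb{C}}\mathcal{M}:\ g(m,m)=g(l,m)=g(n,m)=0,\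 g(m,\overline{m})=-1,\ (l,n,m)\text{ oriented}\},$$ where $(l,n,m)$ oriented means that $\left(\frac{l+n}{\sqrt2},\Re(m),-\Im(m),\frac{l-n}{\sqrt2}\right)$ is an oriented basis (first vector future timelike, the other three spacelike with positively oriented spatial parts). $U(1)$ acts by $m\cdot e^{i\alpha}=e^{i\alpha}m$. $\mathbb{S}^2$ is the unit sphere of $\mathbb{R}^3$ (canonical basis $e_1,e_2,e_3$; $\theta$ is the polar angle from $e_3$), tangent vectors to $\mathbb{S}^2$ at $\omega$ are vectors of $\mathbb{R}^3$ orthogonal to $\omega$, and $\langle\cdot,\cdot\rangle_{\mathbb{R}^3}$ is the canonical scalar product extended $\mathbb{C}$-bilinearly. $(\mathfrak{O}_{\mathbb{S}^2})_\omega$ is the set of $(X,Y)$ such that $(\omega,X,Y)$ is a direct orthonormal basis of $\mathbb{R}^3$ (so $\mathfrak{O}_{\mathbb{S}^2}\cong SO(3)$), with right $U(1)$ action $(X,Y)\cdot e^{i\alpha}=(\cos\alpha\,X+\sin\alpha\,Y,\,-\sin\alpha\,X+\cos\alpha\,Y)$. $\mathbb{R}_t\times(r_0,+\infty)\times\mathfrak{O}_{\mathbb{S}^2}$ is the corresponding $U(1)$ principal bundle over $\mathcal{M}$.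
   Formalization: With the U(1) actions as printed, f(e·z) equals the conjugate of z times f(e), so f is not strictly equivariant; ''isomorphism of U(1) principal bundles'' is proved as a diffeomorphism over the identity of the base, equivariant up to a smooth automorphism of U(1). *)

(* Defs.v *)
From HB Require Import structures.
From mathcomp Require Import all_boot all_order all_algebra.
From mathcomp Require Import all_classical all_reals all_analysis.
From mathcomp Require Import complex ring lra.
Import numFieldNormedType.Exports.
Import Order.TTheory GRing.Theory Num.Theory.

Set Implicit Arguments.
Unset Strict Implicit.
Unset Printing Implicit Defensive.

Local Open Scope classical_set_scope.
Local Open Scope complex_scope.
Local Open Scope ring_scope.

(* Smooth maps between subsets of finite-dimensional normed spaces.  All the
   manifolds below are embedded submanifolds of such spaces, and a map between
   embedded submanifolds is smooth iff it extends locally to a smooth map of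
   the ambient spaces. *)

Fixpoint class_C {R : realType} {V W : normedModType R} (k : nat)
    (U : set V) (F : V -> W) : Prop :=
  match k with
  | 0%N => forall x, U x -> {for x, continuous F}
  | k'.+1 => (forall x, U x -> differentiable F x) /\
             (forall v : V, class_C k' U (fun x => 'D_v F x))
  end.

Definition smooth_on {R : realType} {V W : normedModType R}
    (A : set V) (f : V -> W) : Prop :=
  forall x, A x -> exists (U : set V) (F : V -> W),
    [/\ open U, U x, (forall k, class_C k U F) &
        forall y, A y -> U y -> f y = F y].

Definition diffeomorphism {R : realType} {V W : normedModType R}
    (A : set V) (B : set W) (f : V -> W) : Prop :=
  [/\ forall x, A x -> B (f x), smooth_on A f &
      exists h : W -> V,
        [/\ forall y, B y -> A (h y), smooth_on B h,
            forall x, A x -> h (f x) = x & forall y, B y -> f (h y) = y]].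

Definition U1 {R : realType} : set R[i] := [set z | `|z| = 1].

Definition U1_automorphism {R : realType} (chi : R[i] -> R[i]) : Prop :=
  (forall z w, U1 z -> U1 w -> chi (z * w) = chi z * chi w) /\
  (let circle : set (R * R)%type := [set z | U1 (z.1 +i* z.2)] in
   diffeomorphism circle circle
     (fun z => (complex.Re (chi (z.1 +i* z.2)),
                complex.Im (chi (z.1 +i* z.2))))).

(* Only the data of a U(1) principal bundle: total space, projection and
   right action, the last two relevant on the total space only. *)
Record U1_bundle (R : realType) (E B : Type) := U1Bundle {
  tot_space : set E;
  bproj : E -> B;
  bact : E -> R[i] -> E }.

(* Isomorphism of principal bundles over the identity of the base, in the
   sense of Kobayashi and Nomizu: a morphism of principal bundles includes a
   homomorphism of the structure groups.  For the two actions used below this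
   automorphism is complex conjugation and cannot be the identity, see
   [frame_act_conj]. *)
Definition principal_iso {R : realType} {E E' : normedModType R} {B : Type}
    (P : U1_bundle R E B) (Q : U1_bundle R E' B) (f : E -> E') : Prop :=
  [/\ diffeomorphism (tot_space P) (tot_space Q) f,
      forall x, tot_space P x -> bproj Q (f x) = bproj P x &
      exists2 chi : R[i] -> R[i], U1_automorphism chi &
        forall x z, tot_space P x -> U1 z ->
          f (bact P x z) = bact Q (f x) (chi z)].

(* Euclidean 3-space *)

Definition dot {R : realType} (u v : 'rV[R]_3) : R := (u *m v^T) 0 0.

Definition det3 {R : realType} (u v w : 'rV[R]_3) : R :=
  \det (\matrix_(i < 3) nth 0 [:: u; v; w] i).

Definition row3 {R : realType} (x y z : R) : 'rV[R]_3 :=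
  \row_(i < 3) nth 0 [:: x; y; z] i.

Definition c1 {R : realType} (w : 'rV[R]_3) : R := w 0 0.
Definition c2 {R : realType} (w : 'rV[R]_3) : R := w 0 1.
Definition c3 {R : realType} (w : 'rV[R]_3) : R := w 0 2%:R.

Definition e3 {R : realType} : 'rV[R]_3 := row3 0 0 1.

Definition orthonormal3 {R : realType} (u v w : 'rV[R]_3) : Prop :=
  [/\ dot u u = 1, dot v v = 1 & dot w w = 1] /\
  [/\ dot u v = 0, dot u w = 0 & dot v w = 0].

(* Points and tangent vectors of R_t x R_r x S^2, inside R x R x R^3 *)

Notation point R := (R * R * 'rV[R]_3)%type.
Notation tvec R := (R * R * 'rV[R]_3)%type.

Definition pr {R : realType} (x : point R) : R := x.1.2.
Definition pom {R : realType} (x : point R) : 'rV[R]_3 := x.2.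

Definition dt {R : realType} (v : tvec R) : R := v.1.1.
Definition dr {R : realType} (v : tvec R) : R := v.1.2.
Definition sph_part {R : realType} (v : tvec R) : 'rV[R]_3 := v.2.

Definition ddt {R : realType} : tvec R := (1, 0, 0).
Definition ddr {R : realType} : tvec R := (0, 1, 0).
Definition tsph {R : realType} (X : 'rV[R]_3) : tvec R := (0, 0, X).

Definition r_horizon {R : realType} (M a : R) : R :=
  M + Num.sqrt (M ^+ 2 - a ^+ 2).

Definition exterior {R : realType} (M a : R) : set (point R) :=
  [set x | r_horizon M a < pr x /\ dot (pom x) (pom x) = 1].

Definition tangent {R : realType} (x : point R) (v : tvec R) : Prop :=
  dot (pom x) (sph_part v) = 0.

(* Spherical coordinates: w = (sin th cos ph, sin th sin ph, cos th) *)

Definition cos_th {R : realType} (w : 'rV[R]_3) : R := dot w e3.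
Definition sin_th {R : realType} (w : 'rV[R]_3) : R :=
  Num.sqrt (1 - cos_th w ^+ 2).

(* On tangent vectors: - sin th dth is the differential of cos th = c3, and
   sin^2 th dph = c1 dc2 - c2 dc1. *)
Definition dth {R : realType} (w v : 'rV[R]_3) : R := - c3 v / sin_th w.
Definition dph {R : realType} (w v : 'rV[R]_3) : R :=
  (c1 w * c2 v - c2 w * c1 v) / sin_th w ^+ 2.

Definition ddth {R : realType} (w : 'rV[R]_3) : 'rV[R]_3 :=
  row3 (c1 w * c3 w / sin_th w) (c2 w * c3 w / sin_th w) (- sin_th w).
Definition ddph {R : realType} (w : 'rV[R]_3) : 'rV[R]_3 :=
  row3 (- c2 w) (c1 w) 0.

(* Kerr geometry *)

Definition Delta_r {R : realType} (M a : R) (x : point R) : R :=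
  pr x ^+ 2 - 2 * M * pr x + a ^+ 2.
Definition rho2 {R : realType} (a : R) (x : point R) : R :=
  pr x ^+ 2 + a ^+ 2 * cos_th (pom x) ^+ 2.

(* The coordinate expression away from the axis, and its smooth extension on
   the axis; [kerrE] is the globally smooth expression of the metric. *)
Definition kerr {R : realType} (M a : R) (x : point R) (u v : tvec R) : R :=
  let r := pr x in
  let s := sin_th (pom x) in
  let D := Delta_r M a x in
  let q := rho2 a x in
  let th z := dth (pom x) (sph_part z) in
  let ph z := dph (pom x) (sph_part z) in
  if s != 0 then
    (1 - 2 * M * r / q) * (dt u * dt v)
    + 4 * M * a * r * s ^+ 2 / q * ((dt u * ph v + ph u * dt v) / 2)
    - q / D * (dr u * dr v)
    - q * (th u * th v)
    - s ^+ 2 * (r ^+ 2 + a ^+ 2 + 2 * M * a ^+ 2 * r * s ^+ 2 / q)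
      * (ph u * ph v)
  else
    (1 - 2 * M * r / q) * (dt u * dt v)
    - q / D * (dr u * dr v)
    - q * dot (sph_part u) (sph_part v).

Definition lvec {R : realType} (M a : R) (x : point R) : tvec R :=
  ((pr x ^+ 2 + a ^+ 2) / Delta_r M a x) *: ddt + ddr
  + (a / Delta_r M a x) *: tsph (ddph (pom x)).

Definition nvec {R : realType} (M a : R) (x : point R) : tvec R :=
  ((pr x ^+ 2 + a ^+ 2) / (2 * rho2 a x)) *: ddt
  - (Delta_r M a x / (2 * rho2 a x)) *: ddr
  + (a / (2 * rho2 a x)) *: tsph (ddph (pom x)).

(* In signature (+,-,-,-), two causal vectors with positive product lie in the
   same half of the light cone. *)
Definition future_timelike {R : realType} (M a : R) (x : point R)
    (v : tvec R) : Prop :=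
  [/\ 0 < kerr M a x v v, 0 < kerr M a x v (lvec M a x) &
      0 < kerr M a x v (nvec M a x)].

Definition spacelike {R : realType} (M a : R) (x : point R)
    (v : tvec R) : Prop := kerr M a x v v < 0.

(* Projection to the slice dt = 0 along a timelike vector e0. *)
Definition spatial_part {R : realType} (e0 v : tvec R) : tvec R :=
  v - (dt v / dt e0) *: e0.

(* Orientation of the slices t = const.  The linear isomorphism sending d/dr to
   w and fixing the tangent vectors to the sphere at w is used to compute in
   R^3; the sign is chosen so that (d/dth, - d/dph, d/dr) is positive, see
   [space_positive_coord]. *)
Definition space_positive {R : realType} (x : point R)
    (u v w : tvec R) : Prop :=
  let emb z := dr z *: pom x + sph_part z in
  det3 (emb u) (emb v) (emb w) < 0.

Definition oriented_basis {R : realType} (M a : R) (x : point R)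
    (v0 v1 v2 v3 : tvec R) : Prop :=
  [/\ future_timelike M a x v0,
      [/\ spacelike M a x v1, spacelike M a x v2 & spacelike M a x v3] &
      space_positive x (spatial_part v0 v1) (spatial_part v0 v2)
        (spatial_part v0 v3)].

(* Complexification: the pair (u, v) stands for u + i v. *)

Notation ctvec R := (tvec R * tvec R)%type.

Definition ofreal {R : realType} (u : tvec R) : ctvec R := (u, 0).

Definition cscale {R : realType} (z : R[i]) (m : ctvec R) : ctvec R :=
  (complex.Re z *: m.1 - complex.Im z *: m.2,
   complex.Re z *: m.2 + complex.Im z *: m.1).

Definition cconj {R : realType} (m : ctvec R) : ctvec R := (m.1, - m.2).

Definition kerrC {R : realType} (M a : R) (x : point R)
    (m m' : ctvec R) : R[i] :=
  (kerr M a x m.1 m'.1 - kerr M a x m.2 m'.2)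
  +i* (kerr M a x m.1 m'.2 + kerr M a x m.2 m'.1).

Definition oriented_tetrad {R : realType} (M a : R) (x : point R)
    (l n : tvec R) (m : ctvec R) : Prop :=
  oriented_basis M a x ((Num.sqrt 2)^-1 *: (l + n)) m.1 (- m.2)
    ((Num.sqrt 2)^-1 *: (l - n)).

Definition N0r_total {R : realType} (M a : R) :
    set (point R * ctvec R)%type :=
  [set xm | let: (x, m) := xm in
    let l := lvec M a x in let n := nvec M a x in
    [/\ exterior M a x,
        tangent x m.1 /\ tangent x m.2,
        [/\ kerrC M a x m m = 0, kerrC M a x (ofreal l) m = 0 &
            kerrC M a x (ofreal n) m = 0],
        kerrC M a x m (cconj m) = -1 &
        oriented_tetrad M a x l n m]].

Definition N0r {R : realType} (M a : R) :
    U1_bundle R (point R * ctvec R)%type (point R) :=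
  U1Bundle (N0r_total M a) (fun xm => xm.1)
    (fun xm z => (xm.1, cscale z xm.2)).

(* The bundle R_t x (r0, +oo) x O_{S^2}: elements are (t, r, (w, (X, Y))). *)

Notation framed R :=
  (R * R * ('rV[R]_3 * ('rV[R]_3 * 'rV[R]_3)))%type.

Definition frames_S2 {R : realType} :
    set ('rV[R]_3 * ('rV[R]_3 * 'rV[R]_3))%type :=
  [set wXY | let: (w, (X, Y)) := wXY in
             orthonormal3 w X Y /\ 0 < det3 w X Y].

Definition frame_act {R : realType} (XY : 'rV[R]_3 * 'rV[R]_3) (z : R[i]) :
    'rV[R]_3 * 'rV[R]_3 :=
  (complex.Re z *: XY.1 + complex.Im z *: XY.2,
   - complex.Im z *: XY.1 + complex.Re z *: XY.2).

Definition frame_bundle {R : realType} (M a : R) :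
    U1_bundle R (framed R) (point R) :=
  U1Bundle
    [set e : framed R | r_horizon M a < e.1.2 /\ frames_S2 e.2]
    (fun e => (e.1.1, e.1.2, e.2.1))
    (fun e z => (e.1, (e.2.1, frame_act e.2.2 z))).

Definition kerr_frame_map {R : realType} (a : R) (e : framed R) :
    (point R * ctvec R)%type :=
  let: (t, r, (w, (X, Y))) := e in
  let p : R[i] := r +i* (a * cos_th w) in
  let sq2p : R[i] := (Num.sqrt 2)%:C * p in
  ((t, r, w),
   cscale (- ('i%C * a%:C * (dot X e3 +i* dot Y e3)) / sq2p) (ofreal ddt)
   + cscale (1 / sq2p) (ofreal (tsph X))
   + cscale ('i%C / sq2p) (ofreal (tsph Y))).

(* Checks of the encodings *)

Definition sph {R : realType} (th ph : R) : 'rV[R]_3 :=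
  row3 (sin th * cos ph) (sin th * sin ph) (cos th).

Lemma row3E {R : realType} (x y z : R) :
  [/\ c1 (row3 x y z) = x, c2 (row3 x y z) = y & c3 (row3 x y z) = z].
Proof. by split; rewrite /c1 /c2 /c3 mxE. Qed.

Lemma dotE {R : realType} (u v : 'rV[R]_3) :
  dot u v = c1 u * c1 v + c2 u * c2 v + c3 u * c3 v.
Proof.
rewrite /dot mxE !big_ord_recr big_ord0 /= add0r !mxE /c1 /c2 /c3.
by congr (_ * _ + _ * _ + _ * _); congr (_ _ _); apply/val_inj.
Qed.

Lemma cos_thE {R : realType} (w : 'rV[R]_3) : cos_th w = c3 w.
Proof. by rewrite /cos_th dotE /e3; have [-> -> ->] := row3E 0 0 (1 : R); ring. Qed.

Lemma sin_th_sqr {R : realType} (w : 'rV[R]_3) : dot w w = 1 ->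
  sin_th w ^+ 2 = c1 w ^+ 2 + c2 w ^+ 2.
Proof.
rewrite dotE => h; have e : 1 - cos_th w ^+ 2 = c1 w ^+ 2 + c2 w ^+ 2.
  by rewrite cos_thE -h; ring.
by rewrite /sin_th sqr_sqrtr e // addr_ge0 // sqr_ge0.
Qed.

Lemma sin_th_sph {R : realType} (th ph : R) : 0 <= sin th ->
  sin_th (sph th ph) = sin th /\ cos_th (sph th ph) = cos th.
Proof.
move=> h; rewrite /sin_th cos_thE /sph; have [_ _ ->] := row3E
  (sin th * cos ph) (sin th * sin ph) (cos th).
by rewrite -sin2cos2 sqrtr_sqr ger0_norm.
Qed.

(* ddth and ddph are the coordinate vector fields. *)
Lemma ddth_sph {R : realType} (th ph : R) (k : 'I_3) : 0 < sin th ->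
  is_derive th 1 (fun s => sph s ph 0 k) (ddth (sph th ph) 0 k).
Proof.
move=> h; have [e _] := sin_th_sph ph (ltW h).
have [e1 e2 e3] := row3E (sin th * cos ph) (sin th * sin ph) (cos th).
rewrite /ddth e /sph e1 e2 e3; have h0 : sin th != 0 by rewrite gt_eqF.
case: k => [[|[|[|//]]] ?]; rewrite !mxE /=.
- under eq_fun do rewrite mxE /=.
  by apply: is_derive_eq; rewrite /GRing.scale /=; field.
- under eq_fun do rewrite mxE /=.
  by apply: is_derive_eq; rewrite /GRing.scale /=; field.
- by under eq_fun do rewrite mxE /=; apply: is_derive_eq; rewrite ?scaler1.
Qed.

Lemma ddph_sph {R : realType} (th ph : R) (k : 'I_3) :
  is_derive ph 1 (fun s => sph th s 0 k) (ddph (sph th ph) 0 k).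
Proof.
have [e1 e2 e3] := row3E (sin th * cos ph) (sin th * sin ph) (cos th).
rewrite /ddph /sph e1 e2.
case: k => [[|[|[|//]]] ?]; rewrite !mxE /=.
- under eq_fun do rewrite mxE /=.
  by apply: is_derive_eq; rewrite /GRing.scale /=; ring.
- under eq_fun do rewrite mxE /=.
  by apply: is_derive_eq; rewrite /GRing.scale /=; ring.
- by under eq_fun do rewrite mxE /=; apply: is_derive_eq.
Qed.

Lemma dth_dph_dual {R : realType} (w : 'rV[R]_3) :
  dot w w = 1 -> sin_th w != 0 ->
  [/\ dth w (ddth w) = 1, dth w (ddph w) = 0,
      dph w (ddth w) = 0 & dph w (ddph w) = 1].
Proof.
move=> hw s0; have hs := sin_th_sqr hw; rewrite /dth /dph /ddth /ddph.
have [-> -> ->] := row3E (c1 w * c3 w / sin_th w) (c2 w * c3 w / sin_th w)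
  (- sin_th w).
have [-> -> ->] := row3E (- c2 w) (c1 w) 0.
split; [by field|by rewrite oppr0 mul0r|by field|].
by rewrite mulrN opprK -!expr2 -hs divff // expf_neq0.
Qed.

Lemma det3E {R : realType} (u v w : 'rV[R]_3) :
  det3 u v w = c1 u * (c2 v * c3 w - c3 v * c2 w)
             - c2 u * (c1 v * c3 w - c3 v * c1 w)
             + c3 u * (c1 v * c2 w - c2 v * c1 w).
Proof.
rewrite /det3 !(expand_det_row _ ord0) !big_ord_recr big_ord0 /= add0r.
rewrite /cofactor !(expand_det_row _ ord0) !big_ord_recr !big_ord0 /= !add0r.
rewrite /cofactor !det_mx11 !mxE /= /c1 /c2 /c3 /bump /=.
have [F E] : exists F : 'rV[R]_3 -> nat -> R, forall (z : 'rV[R]_3) (i : 'I_3), z 0 i = F z (val i).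
  by exists (fun z k => z 0 (inord k)) => z i; rewrite inord_val.
rewrite !E /= /bump /= !addn0 !add0n !addn1 /=.
ring.
Qed.

Lemma space_positive_coord {R : realType} (x : point R) :
  dot (pom x) (pom x) = 1 -> sin_th (pom x) != 0 ->
  space_positive x (tsph (ddth (pom x))) (- tsph (ddph (pom x))) ddr.
Proof.
case: x => -[t r] w; rewrite /pom /= => hw s0; have hs := sin_th_sqr hw.
rewrite /space_positive /dr /sph_part /pom /=.
rewrite oppr0 !scale0r !add0r scale1r addr0.
have NE (z : 'rV[R]_3) : [/\ c1 (- z) = - c1 z, c2 (- z) = - c2 z &
  c3 (- z) = - c3 z] by split; rewrite /c1 /c2 /c3 mxE.
rewrite det3E; have [-> -> ->] := NE (ddph w); rewrite /ddth /ddph.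
have [-> -> ->] := row3E (c1 w * c3 w / sin_th w) (c2 w * c3 w / sin_th w)
  (- sin_th w).
have [-> -> ->] := row3E (- c2 w) (c1 w) 0.
have sp : 0 < sin_th w by rewrite lt_def s0 sqrtr_ge0.
suff -> : c1 w * c3 w / sin_th w * (- c1 w * c3 w - - 0 * c2 w)
   - c2 w * c3 w / sin_th w * (- - c2 w * c3 w - - 0 * c1 w)
   + - sin_th w * (- - c2 w * c2 w - - c1 w * c1 w) = - sin_th w.
  by rewrite oppr_lt0.
have h : c3 w ^+ 2 = 1 - sin_th w ^+ 2.
  by rewrite hs -hw dotE; ring.
transitivity (- (c3 w ^+ 2 * (c1 w ^+ 2 + c2 w ^+ 2) / sin_th w)
              - sin_th w * (c1 w ^+ 2 + c2 w ^+ 2)); first by field.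
by rewrite h -hs; field.
Qed.

(* The rotation of frames is e^{-i alpha} on X + i Y. *)
Lemma frame_act_conj {R : realType} (X Y : 'rV[R]_3) (z : R[i]) :
  let XY' := frame_act (X, Y) z in
  cscale 1 (ofreal (tsph XY'.1)) + cscale 'i%C (ofreal (tsph XY'.2)) =
  cscale z^*%C
    (cscale 1 (ofreal (tsph X)) + cscale 'i%C (ofreal (tsph Y))).
Proof.
case: z => c s; rewrite /cscale /frame_act /tsph /ofreal /=.
congr ((_, _, _), (_, _, _)); rewrite /=;
  try by rewrite /GRing.scale /=; ring.
- by apply/rowP => i; rewrite !mxE; ring.
- by apply/rowP => i; rewrite !mxE; ring.
Qed.

(* The smooth expression of the metric, with sin^2 th dph written b. *)
Lemma kerrE {R : realType} (M a : R) (x : point R) (u v : tvec R) :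
  0 < pr x -> dot (pom x) (pom x) = 1 -> tangent x u -> tangent x v ->
  let r := pr x in
  let q := rho2 a x in
  let b z := c1 (pom x) * c2 (sph_part z) - c2 (pom x) * c1 (sph_part z) in
  kerr M a x u v =
    (1 - 2 * M * r / q) * (dt u * dt v)
    + 2 * M * a * r / q * (dt u * b v + b u * dt v)
    - q / Delta_r M a x * (dr u * dr v)
    - q * dot (sph_part u) (sph_part v)
    - a ^+ 2 * (1 + 2 * M * r / q) * (b u * b v).
Proof.
move=> r0 hw; rewrite /tangent /kerr; move: hw.
set w := pom x; set U := sph_part u; set V := sph_part v => hw tu tv /=.
have hs := sin_th_sqr hw.
have q0 : rho2 a x != 0.
  by rewrite gt_eqF // ltr_wpDr ?exprn_gt0 // mulr_ge0 ?sqr_ge0.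
have hr : rho2 a x = pr x ^+ 2 + a ^+ 2 - a ^+ 2 * sin_th w ^+ 2.
  rewrite /rho2 -/w cos_thE hs.
  have -> : c1 w ^+ 2 + c2 w ^+ 2 = 1 - c3 w ^+ 2 by rewrite -hw dotE; ring.
  by ring.
have hr2 : pr x ^+ 2 + a ^+ 2 = rho2 a x + a ^+ 2 * sin_th w ^+ 2.
  by rewrite hr; ring.
move: tu tv; rewrite !dotE => tu tv.
case: ifPn => [s0|]; last first.
  rewrite negbK => /eqP s0; move: hs; rewrite s0 expr0n /= => /esym/eqP.
  rewrite paddr_eq0 ?sqr_ge0 // !sqrf_eq0 => /andP[/eqP-> /eqP->]; ring.
rewrite hr2 /dth /dph -/w -/U -/V.
set bu := c1 w * c2 U - _; set bv := c1 w * c2 V - _.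
have D : c1 U * c1 V + c2 U * c2 V + c3 U * c3 V =
   (c3 U * c3 V + bu * bv) / sin_th w ^+ 2.
  have h3 : c3 w ^+ 2 = 1 - sin_th w ^+ 2 by rewrite hs -hw dotE; ring.
  apply: (canRL (mulfK _)); first by rewrite expf_neq0.
  transitivity ((c1 w ^+ 2 + c2 w ^+ 2) * (c1 U * c1 V + c2 U * c2 V)
    + sin_th w ^+ 2 * (c3 U * c3 V)); first by rewrite hs; ring.
  have -> : (c1 w ^+ 2 + c2 w ^+ 2) * (c1 U * c1 V + c2 U * c2 V) =
    bu * bv + (c1 w * c1 U + c2 w * c2 U) * (c1 w * c1 V + c2 w * c2 V).
    by rewrite /bu /bv; ring.
  have -> : c1 w * c1 U + c2 w * c2 U = - (c3 w * c3 U).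
    by apply/eqP; rewrite -subr_eq0 opprK tu.
  have -> : c1 w * c1 V + c2 w * c2 V = - (c3 w * c3 V).
    by apply/eqP; rewrite -subr_eq0 opprK tv.
  transitivity (bu * bv + c3 w ^+ 2 * (c3 U * c3 V)
     + sin_th w ^+ 2 * (c3 U * c3 V)); first by ring.
  by rewrite h3; ring.
rewrite D; clear D; move: bu bv (dt u) (dt v) (dr u) (dr v) (c3 U) (c3 V) => *.
case: (eqVneq (Delta_r M a x) 0) => [->|D0]; first by rewrite invr0; field; rewrite s0 q0.
by field; rewrite s0 q0 D0.
Qed.

(* Main.v *)
(* Put e = (r + i a cos th)^-1 / sqrt 2.  Orthogonality to l and n means
   dr m = 0 and dt m = a sin^2 th dph m, and on these vectors the Kerr metric is
   - rho^2 times the Euclidean product of the spherical parts.  Hence a point of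
   the tetrad bundle is m = U + i (w x U) plus its determined d/dt component,
   with 2 rho^2 |U|^2 = 1: the orientation selects w x U rather than - w x U
   because the spatial determinant is a positive multiple of det (w, Re m, Im m).
   Since |e|^2 = 1 / (2 rho^2), multiplication by e takes X + i Y to such vectors,
   and its inverse, multiplication by sqrt 2 (r + i a cos th), is polynomial. *)

From HB Require Import structures.
From mathcomp Require Import all_boot all_order all_algebra.
From mathcomp Require Import all_classical all_reals all_analysis.
From mathcomp Require Import complex ring lra.
Require Import Defs.
Import numFieldNormedType.Exports.
Import Order.TTheory GRing.Theory Num.Theory.
Local Open Scope classical_set_scope.
Local Open Scope complex_scope.
Local Open Scope ring_scope.
Set Implicit Arguments.
Unset Strict Implicit.
Unset Printing Implicit Defensive.

(** * Closure properties of maps of class C^k *)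

(** The first-order expansion of [f] at [x] is also one of [g], because it only involves values near
    [x]. *)
Lemma near_eq_differentiable (R : numFieldType) (V W : normedModType R)
    (f g : V -> W) (x : V) :
  {near x, f =1 g} -> differentiable f x -> differentiable g x.
Proof.
move=> fg df; have cdf := diff_continuous df.
have e : g \o shift x = cst (g x) + 'd f x +o_ 0 id.
  apply/eqaddoP => _/posnumP[eps]; have /eqaddoP/(_ _ (gt0 eps)) fe :=
    diff_locally df.
  move: (fg); rewrite (near_shift 0) subr0 => fg'; rewrite -(nbhs_singleton fg).
  near=> h; have : f (h + x) = g (h + x).
    by near: h; exact: fg'.
  by rewrite -[(g \o _ - _) h]/(g (h + x) - _) => <-; near: h.
by apply/diff_locallyP; rewrite (diff_unique cdf e).
Unshelve. all: by end_near. Qed.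

Section ClassC.
Context {R : realType}.
Implicit Types V W : normedModType R.

Lemma class_CW V W (U : set V) (F : V -> W) k :
  class_C k.+1 U F -> class_C k U F.
Proof.
elim: k F => [|k IH] F [dF cF].
  by move=> x Ux; exact/differentiable_continuous/dF.
by split=> // v; exact/IH/cF.
Qed.

(** On an open set, pointwise equality gives equality near each point, hence equal directional
    derivatives. Formulas for ['D_v] valid only on [U] can thus feed the inductions below. *)
Lemma eq_class_C V W (U : set V) (F G : V -> W) k : open U ->
  (forall x, U x -> F x = G x) -> class_C k U F -> class_C k U G.
Proof.
move=> oU; elim: k F G => [|k IH] F G FG /=.
all: have nFG x : U x -> {near x, F =1 G} by
  move=> Ux; near=> y; apply: FG; near: y; exact: open_nbhs_nbhs.
  move=> cF x Ux; rewrite /prop_for /continuous_at -(FG _ Ux).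
  exact: cvg_trans (near_eq_cvg (nFG _ Ux)) (cF x Ux).
move=> [dF cF]; split => [x Ux|v].
  exact: near_eq_differentiable (nFG _ Ux) (dF _ Ux).
by apply: IH (cF v) => x Ux; apply: near_eq_derive; exact: nFG.
Unshelve. all: by end_near. Qed.

Lemma class_C_cst V W (U : set V) (c : W) k : class_C k U (fun=> c).
Proof.
elim: k c => [|k IH] c; first by move=> x _; exact: cvg_cst.
split=> [x _|v]; first exact: differentiable_cst.
by under eq_fun do rewrite derive_cst; exact: IH.
Qed.

(** A continuous linear map commutes with ['D_v], which closes the induction. Projections,
    coordinates, the opposite and [t *: c] are instances. *)
Lemma class_C_linear_comp V W (W' : normedModType R) (L : {linear W -> W'})
    (U : set V) (F : V -> W) k :
  open U -> continuous L -> class_C k U F -> class_C k U (fun x => L (F x)).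
Proof.
move=> oU cL; elim: k F => [|k IH] F /=.
  by move=> cF x Ux; apply: continuous_comp; [exact: cF|exact: cL].
move=> [dF cF]; split=> [x Ux|v].
  by apply: (differentiable_comp (dF _ Ux)); exact: linear_differentiable.
apply: eq_class_C (IH _ (cF v)) => // x Ux.
have dL : differentiable L (F x) by exact: linear_differentiable.
have dLF : differentiable (L \o F) x by exact: differentiable_comp (dF _ Ux) dL.
rewrite (deriveE _ (dF _ Ux)) -[fun y => _]/(L \o F) (deriveE _ dLF).
by rewrite (diff_comp (dF _ Ux) dL) /= diff_lin.
Qed.

Lemma class_C_linear V W (L : {linear V -> W}) (U : set V) k :
  continuous L -> class_C k U L.
Proof.
move=> cL; case: k => [x _|k]; first exact: cL.
split=> [x _|v]; first exact: linear_differentiable.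
rewrite (_ : (fun _ => _) = fun=> L v); first exact: class_C_cst.
apply/funext => x; rewrite deriveE; last exact: linear_differentiable.
by rewrite diff_lin.
Qed.

Lemma class_CD V W (U : set V) (F G : V -> W) k : open U ->
  class_C k U F -> class_C k U G -> class_C k U (fun x => F x + G x).
Proof.
move=> oU; elim: k F G => [|k IH] F G /=.
  by move=> cF cG x Ux; apply: continuousD; [exact: cF|exact: cG].
move=> [dF cF] [dG cG]; split=> [x Ux|v].
  by apply: differentiableD; [exact: dF|exact: dG].
apply: eq_class_C (IH _ _ (cF v) (cG v)) => // x Ux.
by rewrite -deriveD //; apply/diff_derivable; [exact: dF|exact: dG].
Qed.

(** Leibniz rule; the undifferentiated factors are lowered to order [k] by [class_CW]. *)
Lemma class_CM V (U : set V) (f g : V -> R) k : open U ->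
  class_C k U f -> class_C k U g -> class_C k U (fun x => f x * g x).
Proof.
move=> oU; elim: k f g => [|k IH] f g.
  by move=> cf cg x Ux; apply: continuousM; [exact: cf|exact: cg].
move=> cf1 cg1; have cf0 := class_CW cf1; have cg0 := class_CW cg1.
case: cf1 => df cf; case: cg1 => dg cg; split=> [x Ux|v].
  by apply: differentiableM; [exact: df|exact: dg].
apply: eq_class_C (class_CD oU (IH _ _ cf0 (cg v)) (IH _ _ cg0 (cf v))) => //.
by move=> x Ux; rewrite -[fun y => f y * g y]/(f * g) deriveM //;
  apply/diff_derivable; [exact: df|exact: dg].
Qed.

(** The derivative [- f^-2 * 'D_v f] is a product of functions already known to be of class C^k. *)
Lemma class_CV V (U : set V) (f : V -> R) k : open U ->
  (forall x, U x -> f x != 0) ->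
  class_C k U f -> class_C k U (fun x => (f x)^-1).
Proof.
move=> oU f0; elim: k => [|k IH].
  by move=> cf x Ux; apply: cvgV; [exact: f0|exact: cf].
move=> cf1; have cf0 := class_CW cf1.
case: cf1 => df cf; split=> [x Ux|v].
  by apply: differentiableV; [exact: df|exact: f0].
have cV := IH cf0; have cN : class_C k U (fun x => -1 * 'D_v f x).
  exact: class_CM oU (class_C_cst U (-1 : R) k) (cf v).
apply: eq_class_C (class_CM oU (class_CM oU cV cV) cN) => // x Ux.
rewrite deriveV; [|exact: f0|exact/diff_derivable/df].
by rewrite /GRing.scale /= -exprVn; ring.
Qed.

Lemma class_C_scale V W (U : set V) (f : V -> R) (c : W) k : open U ->
  class_C k U f -> class_C k U (fun x => f x *: c).
Proof.
move=> oU.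
pose S (t : R) := t *: c.
have linS : linear S by move=> u y z; rewrite /S scalerDl scalerA.
pose LM := GRing.isLinear.Build _ _ _ _ _ linS.
pose L : {linear R -> W} := HB.pack S LM.
by apply: (@class_C_linear_comp _ _ _ L) => //; exact: scalel_continuous.
Qed.

Lemma class_C_row V n (U : set V) (F : V -> 'rV[R]_n.+1) k : open U ->
  (forall i, class_C k U (fun x => F x 0 i)) -> class_C k U F.
Proof.
move=> oU cF.
rewrite (_ : F = fun x => \sum_i F x 0 i *: delta_mx 0 i); last first.
  by apply/funext => x; exact: row_sum_delta.
(* The sum is generalised to an arbitrary list of indices for the induction. *)
elim: (index_enum _) => [|i s IH].
  by under eq_fun do rewrite big_nil; exact: class_C_cst.
under eq_fun do rewrite big_cons.
exact/(class_CD oU)/IH/class_C_scale/cF.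
Qed.

Lemma class_C_pair V W W' (U : set V) (F : V -> W) (G : V -> W') k : open U ->
  class_C k U F -> class_C k U G -> class_C k U (fun x => (F x, G x)).
Proof.
move=> oU; elim: k F G => [|k IH] F G /=.
  by move=> cF cG x Ux; apply: cvg_pair; [exact: cF|exact: cG].
move=> [dF cF] [dG cG]; split=> [x Ux|v].
  by apply: differentiable_pair; [exact: dF|exact: dG].
apply: eq_class_C (IH _ _ (cF v) (cG v)) => // x Ux.
have dFx := dF _ Ux; have dGx := dG _ Ux.
rewrite !deriveE //; last exact: differentiable_pair.
by rewrite diff_pair.
Qed.

Lemma class_C_id V (U : set V) k : class_C k U id.
Proof. by apply: (@class_C_linear _ _ idfun) => x; exact: cvg_id. Qed.

Lemma class_C_fst V W W' (U : set V) (F : V -> W * W') k : open U ->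
  class_C k U F -> class_C k U (fun x => (F x).1).
Proof.
by move=> oU; apply: (@class_C_linear_comp _ _ _ fst) => // x; exact: cvg_fst.
Qed.

Lemma class_C_snd V W W' (U : set V) (F : V -> W * W') k : open U ->
  class_C k U F -> class_C k U (fun x => (F x).2).
Proof.
by move=> oU; apply: (@class_C_linear_comp _ _ _ snd) => // x; exact: cvg_snd.
Qed.

Lemma class_CN V W (U : set V) (F : V -> W) k : open U ->
  class_C k U F -> class_C k U (fun x => - F x).
Proof.
move=> oU; apply: (@class_C_linear_comp _ _ _ -%R) => //.
exact: opp_continuous.
Qed.

Lemma class_C_coord V n (U : set V) (F : V -> 'rV[R]_n.+1) i k : open U ->
  class_C k U F -> class_C k U (fun x => F x 0 i).
Proof.
move=> oU.
pose C (v : 'rV[R]_n.+1) := v 0 i.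
have linC : linear C by move=> t y z; rewrite /C !mxE.
pose LM := GRing.isLinear.Build _ _ _ _ _ linC.
pose L : {linear 'rV[R]_n.+1 -> R} := HB.pack C LM.
by apply: (@class_C_linear_comp _ _ _ L) => //; exact: coord_continuous.
Qed.

Lemma class_CZ V n (U : set V) (f : V -> R) (F : V -> 'rV[R]_n.+1) k : open U ->
  class_C k U f -> class_C k U F -> class_C k U (fun x => f x *: F x).
Proof.
move=> oU cf cF; apply: class_C_row => // i; under eq_fun do rewrite mxE.
by apply: class_CM => //; exact: class_C_coord.
Qed.

End ClassC.

(** * Oriented frames in Euclidean 3-space *)

Section Euclid.
Context {R : realType}.
Implicit Types u v w X Y : 'rV[R]_3.

Definition cross u v : 'rV[R]_3 :=
  row3 (c2 u * c3 v - c3 u * c2 v) (c3 u * c1 v - c1 u * c3 v)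
       (c1 u * c2 v - c2 u * c1 v).

(** A product of equations acts as a multirule for [rewrite]. *)
Lemma coord_row3 (x y z : R) : (c1 (row3 x y z) = x)%R *
  (c2 (row3 x y z) = y)%R * (c3 (row3 x y z) = z)%R.
Proof. by have [-> -> ->] := row3E x y z. Qed.

Lemma coord0 : (c1 (0 : 'rV[R]_3) = 0)%R * (c2 (0 : 'rV[R]_3) = 0)%R *
  (c3 (0 : 'rV[R]_3) = 0)%R.
Proof. by rewrite /c1 /c2 /c3 !mxE. Qed.

Lemma coordN u : (c1 (- u) = - c1 u)%R * (c2 (- u) = - c2 u)%R *
  (c3 (- u) = - c3 u)%R.
Proof. by rewrite /c1 /c2 /c3 !mxE. Qed.

Lemma coordD u v : (c1 (u + v) = c1 u + c1 v)%R *
  (c2 (u + v) = c2 u + c2 v)%R * (c3 (u + v) = c3 u + c3 v)%R.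
Proof. by rewrite /c1 /c2 /c3 !mxE. Qed.

Lemma coordZ (k : R) u : (c1 (k *: u) = k * c1 u)%R *
  (c2 (k *: u) = k * c2 u)%R * (c3 (k *: u) = k * c3 u)%R.
Proof. by rewrite /c1 /c2 /c3 !mxE. Qed.

Definition coordE := (coord_row3, coord0, coordN, coordD, coordZ).

Lemma coordP u v : c1 u = c1 v -> c2 u = c2 v -> c3 u = c3 v -> u = v.
Proof.
move=> h1 h2 h3; apply/rowP => -[[|[|[|//]]] p].
- by rewrite (_ : Ordinal p = 0) //; exact/val_inj.
- by rewrite (_ : Ordinal p = 1) //; exact/val_inj.
- by rewrite (_ : Ordinal p = 2%:R) //; exact/val_inj.
Qed.

Lemma dot_ge0 u : 0 <= dot u u.
Proof. by rewrite dotE -!expr2 !addr_ge0 ?sqr_ge0. Qed.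

Lemma dot_eq0 u : dot u u = 0 -> u = 0.
Proof.
rewrite dotE -!expr2 => /eqP.
rewrite !paddr_eq0 ?addr_ge0 ?sqr_ge0 // !sqrf_eq0.
by move=> /andP[/andP[/eqP h1 /eqP h2] /eqP h3]; apply: coordP; rewrite coord0.
Qed.

Lemma dot_crossl w X : dot w (cross w X) = 0.
Proof. by rewrite dotE /cross !coordE; ring. Qed.

Lemma dot_crossr w X : dot X (cross w X) = 0.
Proof. by rewrite dotE /cross !coordE; ring. Qed.

Lemma dot_cross_cross w X :
  dot (cross w X) (cross w X) = dot w w * dot X X - dot w X ^+ 2.
Proof. by rewrite !dotE /cross !coordE; ring. Qed.

Lemma det3_cross w X : det3 w X (cross w X) = dot w w * dot X X - dot w X ^+ 2.
Proof. by rewrite det3E !dotE /cross !coordE; ring. Qed.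

(** The triple product expansion. For [X] orthogonal to a unit vector [w] it says that [cross w]
    squares to -1: it is the complex structure of the tangent plane. *)
Lemma cross_cross w X : cross w (cross w X) = dot w X *: w - dot w w *: X.
Proof. by apply: coordP; rewrite !dotE /cross !coordE; ring. Qed.

(** The Gram determinant gives [det3 w X Y ^+ 2 = dot X X ^+ 2], positivity selects the root
    [dot X X], and then the squared length of [Y - cross w X] expands to 0. The common length stays
    free, to cover both frames and tetrads. *)
Lemma crossP w X Y : dot w w = 1 -> dot w X = 0 -> dot w Y = 0 ->
  dot X Y = 0 -> dot Y Y = dot X X -> 0 < det3 w X Y -> Y = cross w X.
Proof.
move=> w1 wX wY XY YX D0.
have gram : det3 w X Y ^+ 2 = dot X X ^+ 2.
  have : det3 w X Y ^+ 2 = dot w w * (dot X X * dot Y Y - dot X Y ^+ 2)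
    - dot w X * (dot w X * dot Y Y - dot X Y * dot w Y)
    + dot w Y * (dot w X * dot X Y - dot X X * dot w Y).
    by rewrite det3E !dotE; ring.
  by rewrite w1 wX wY XY YX => ->; ring.
have DX : det3 w X Y = dot X X.
  by apply/eqP; rewrite -(@eqrXn2 _ 2) // ?dot_ge0 ?gram // ltW.
apply/subr0_eq/dot_eq0.
transitivity (dot Y Y - 2 * det3 w X Y + (dot w w * dot X X - dot w X ^+ 2)).
  by rewrite det3E !dotE /cross !coordE; ring.
by rewrite DX YX w1 wX; ring.
Qed.

(** Since [crossP] forces [Y], computations on frames reduce to [w] and [X]. *)
Lemma frames_S2P w X Y : frames_S2 (w, (X, Y)) <->
  [/\ dot w w = 1, dot w X = 0, dot X X = 1 & Y = cross w X].
Proof.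
split=> [[[[w1 X1 Y1] [wX wY XY]] D0]|[w1 wX X1 ->]].
  by split=> //; apply: crossP => //; rewrite Y1.
split; last by rewrite det3_cross w1 wX X1 expr0n mulr1 subr0.
split; split=> //; rewrite ?dot_crossl ?dot_crossr //.
by rewrite dot_cross_cross w1 wX X1 expr0n mulr1 subr0.
Qed.

(** [cross X Y] equals [det3 w X Y *: w]; [c3 w] times its third component is the term that the left
    side lacks from the expansion of the determinant. *)
Lemma det3_ddph w X Y : dot w w = 1 -> dot w X = 0 -> dot w Y = 0 ->
  (c1 w * c2 X - c2 w * c1 X) * c3 Y - (c1 w * c2 Y - c2 w * c1 Y) * c3 X =
  det3 w X Y * (1 - c3 w ^+ 2).
Proof.
move=> w1 wX wY.
have XYw : c1 X * c2 Y - c2 X * c1 Y = c3 w * det3 w X Y.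
  transitivity (dot w w * (c1 X * c2 Y - c2 X * c1 Y)); first by rewrite w1 mul1r.
  transitivity (c3 w * det3 w X Y + dot w X * (c1 w * c2 Y - c2 w * c1 Y)
    - dot w Y * (c1 w * c2 X - c2 w * c1 X)); first by rewrite det3E !dotE; ring.
  by rewrite wX wY; ring.
transitivity (det3 w X Y - c3 w * (c1 X * c2 Y - c2 X * c1 Y)).
  by rewrite det3E; ring.
by rewrite XYw; ring.
Qed.

(** The rows have the shape of the spatial parts of Re m, - Im m and a multiple of [l - n].
    Multiples of [w] cancel against the last row, and [cross w (ddph w)] pairs with tangent vectors
    as [e3] does. *)
Lemma det3_wedge_w w X Y (p p' q q' k : R) :
  dot w w = 1 -> dot w X = 0 -> dot w Y = 0 ->
  det3 (X - p *: ddph w - p' *: w) (- Y + q *: ddph w + q' *: w) (k *: w) =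
  - (k * (det3 w X Y - (p * c3 Y - q * c3 X))).
Proof.
move=> w1 wX wY.
transitivity (- (k * (det3 w X Y - (p * (dot w w * c3 Y - dot w Y * c3 w)
  - q * (dot w w * c3 X - dot w X * c3 w))))).
  by rewrite !det3E !dotE /ddph !coordE; ring.
by rewrite w1 wX wY; ring.
Qed.

End Euclid.

(** * The Kerr metric and the null tetrads *)

Section Kerr.
Context {R : realType} (M a : R).
Hypotheses (a_gt0 : 0 < a) (aM : a < M).
Implicit Types (x : point R) (u v : tvec R).

(** * Positivity outside the horizon *)

Lemma exterior_gtM x : exterior M a x -> M < pr x.
Proof. by case=> + _; apply: le_lt_trans; rewrite lerDl sqrtr_ge0. Qed.

Lemma exterior_pr_gt0 x : exterior M a x -> 0 < pr x.
Proof. by move=> /exterior_gtM; apply: lt_trans; exact: lt_trans aM. Qed.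

(** [Delta_r] is [(r - M)^2 - (M^2 - a^2)], and [r - M] exceeds the square root of [M^2 - a^2]. *)
Lemma Delta_r_gt0 x : exterior M a x -> 0 < Delta_r M a x.
Proof.
move=> ex; have Mr := exterior_gtM ex; case: ex => rx _.
have := rx; rewrite /r_horizon -ltrBrDl => h.
have s0 : 0 <= M ^+ 2 - a ^+ 2.
  by rewrite subr_ge0 ler_sqr ?nnegrE ?ltW // (lt_trans a_gt0).
have : Num.sqrt (M ^+ 2 - a ^+ 2) ^+ 2 < (pr x - M) ^+ 2.
  by rewrite ltr_sqr ?nnegrE ?sqrtr_ge0 // subr_ge0 ltW.
rewrite sqr_sqrtr // -subr_gt0 /Delta_r; congr (_ < _); ring.
Qed.

Lemma rho2_gt0 x : 0 < pr x -> 0 < rho2 a x.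
Proof. by move=> r0; rewrite ltr_wpDr ?exprn_gt0 // mulr_ge0 ?sqr_ge0. Qed.

(* [sin^2 th dph], defined also on the axis *)
Definition sin2_dph x u : R :=
  c1 (pom x) * c2 (sph_part u) - c2 (pom x) * c1 (sph_part u).

(** * Tangent vectors and bilinearity of the metric *)

Lemma tangent_lvec x : tangent x (lvec M a x).
Proof. by rewrite /tangent dotE /lvec /sph_part /ddph /= !coordE; ring. Qed.

Lemma tangent_nvec x : tangent x (nvec M a x).
Proof. by rewrite /tangent dotE /nvec /sph_part /ddph /= !coordE; ring. Qed.

Lemma tangentD x u v : tangent x u -> tangent x v -> tangent x (u + v).
Proof. by rewrite /tangent !dotE /sph_part /= !coordE => hu hv; lra. Qed.

Lemma tangentZ x k u : tangent x u -> tangent x (k *: u).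
Proof. rewrite /tangent !dotE /sph_part /= !coordE => hu.
by rewrite -[RHS](mulr0 k) -hu; ring.
Qed.

Lemma tangent0 x : tangent x 0.
Proof. by rewrite /tangent dotE /sph_part /= !coordE; ring. Qed.

(** Read off [kerrE], which has no case distinction at the axis but is stated for tangent
    vectors. *)
Lemma kerr_linearl x k k' u v y : 0 < pr x -> dot (pom x) (pom x) = 1 ->
  tangent x u -> tangent x v -> tangent x y ->
  kerr M a x (k *: u + k' *: v) y = k * kerr M a x u y + k' * kerr M a x v y.
Proof.
move=> r0 w1 tu tv ty; rewrite !kerrE //; last first.
  exact/tangentD/tangentZ/tv/tangentZ.
rewrite !dotE /dt /dr /sph_part /= !coordE.
set h := 2 * M * _ / _; set h' := 2 * M * _ * _ / _; set h'' := rho2 a x / _.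
by rewrite /GRing.scale /=; ring.
Qed.

Lemma kerr_sym x u v : 0 < pr x -> dot (pom x) (pom x) = 1 ->
  tangent x u -> tangent x v -> kerr M a x u v = kerr M a x v u.
Proof.
move=> r0 w1 tu tv; rewrite !kerrE // !dotE.
set h := 2 * M * _ / _; set h' := 2 * M * _ * _ / _; set h'' := rho2 a x / _.
by ring.
Qed.

(** * Products with the principal null vectors *)

Lemma rho2E x : dot (pom x) (pom x) = 1 -> rho2 a x =
  pr x ^+ 2 + a ^+ 2 - a ^+ 2 * (c1 (pom x) ^+ 2 + c2 (pom x) ^+ 2).
Proof.
move=> w1; rewrite /rho2 cos_thE.
have -> : c1 (pom x) ^+ 2 + c2 (pom x) ^+ 2 = 1 - c3 (pom x) ^+ 2.
  by rewrite -w1 dotE; ring.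
by ring.
Qed.

Lemma rho2D x : dot (pom x) (pom x) = 1 -> pr x ^+ 2 + a ^+ 2 =
  rho2 a x + a ^+ 2 * (c1 (pom x) ^+ 2 + c2 (pom x) ^+ 2).
Proof. by move=> w1; rewrite rho2E //; ring. Qed.

(** Eliminates the mass, so that [rho2] and [Delta_r] can be generalised to positive variables
    before [field]. *)
Lemma mass_rho2 x : pr x != 0 -> dot (pom x) (pom x) = 1 ->
  M = (rho2 a x + a ^+ 2 * (c1 (pom x) ^+ 2 + c2 (pom x) ^+ 2)
       - Delta_r M a x) / (2 * pr x).
Proof. by move=> r0 w1; rewrite rho2E // /Delta_r; field. Qed.

(** The covector of [l]. It and that of [n] only involve [dr] and the combination
    [dt - a sin^2 th dph]. *)
Lemma kerr_lvec x u : exterior M a x -> tangent x u ->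
  kerr M a x (lvec M a x) u =
  dt u - a * sin2_dph x u - rho2 a x / Delta_r M a x * dr u.
Proof.
move=> ex tu; have r0 := exterior_pr_gt0 ex; have q0 := rho2_gt0 r0.
have D0 := Delta_r_gt0 ex; have [_ w1] := ex.
rewrite kerrE //; last exact: tangent_lvec.
rewrite /lvec /sin2_dph /ddph !dotE /dt /dr /sph_part /= !coordE.
rewrite /GRing.scale /=.
rewrite rho2D //; have := mass_rho2 (lt0r_neq0 r0) w1.
move: (rho2 a x) (Delta_r M a x) q0 D0 => q D q0 D0 ->.
by field; rewrite !gt_eqF.
Qed.

Lemma kerr_nvec x u : exterior M a x -> tangent x u ->
  kerr M a x (nvec M a x) u = Delta_r M a x / (2 * rho2 a x) *
  (dt u - a * sin2_dph x u + rho2 a x / Delta_r M a x * dr u).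
Proof.
move=> ex tu; have r0 := exterior_pr_gt0 ex; have q0 := rho2_gt0 r0.
have D0 := Delta_r_gt0 ex; have [_ w1] := ex.
rewrite kerrE //; last exact: tangent_nvec.
rewrite /nvec /sin2_dph /ddph !dotE /dt /dr /sph_part /= !coordE.
rewrite /GRing.scale /=.
rewrite rho2D //; have := mass_rho2 (lt0r_neq0 r0) w1.
move: (rho2 a x) (Delta_r M a x) q0 D0 => q D q0 D0 ->.
by field; rewrite !gt_eqF.
Qed.

Lemma kerr_ll x : exterior M a x -> kerr M a x (lvec M a x) (lvec M a x) = 0.
Proof.
move=> ex; have r0 := exterior_pr_gt0 ex; have q0 := rho2_gt0 r0.
have D0 := Delta_r_gt0 ex; have [_ w1] := ex.
rewrite kerr_lvec //; last exact: tangent_lvec.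
rewrite /lvec /sin2_dph /ddph /dt /dr /sph_part /= !coordE /GRing.scale /=.
rewrite rho2E //.
by field; rewrite gt_eqF.
Qed.

Lemma kerr_nl x : exterior M a x -> kerr M a x (nvec M a x) (lvec M a x) = 1.
Proof.
move=> ex; have r0 := exterior_pr_gt0 ex; have q0 := rho2_gt0 r0.
have D0 := Delta_r_gt0 ex; have [_ w1] := ex.
rewrite kerr_nvec //; last exact: tangent_lvec.
rewrite /lvec /sin2_dph /ddph /dt /dr /sph_part /= !coordE /GRing.scale /=.
rewrite rho2D //.
by field; rewrite !gt_eqF.
Qed.

Lemma kerr_nn x : exterior M a x -> kerr M a x (nvec M a x) (nvec M a x) = 0.
Proof.
move=> ex; have r0 := exterior_pr_gt0 ex; have q0 := rho2_gt0 r0.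
have D0 := Delta_r_gt0 ex; have [_ w1] := ex.
rewrite kerr_nvec //; last exact: tangent_nvec.
rewrite /nvec /sin2_dph /ddph /dt /dr /sph_part /= !coordE /GRing.scale /=.
rewrite rho2D //.
by field; rewrite !gt_eqF.
Qed.

(* The null conditions [dr u = 0] and [dt u = a sin^2 th dph u] cut out the
   orthogonal complement of [l, n], where the metric is [- rho^2] times the
   Euclidean one. *)
Lemma kerr_orthogonal x u v : exterior M a x -> tangent x u -> tangent x v ->
  dr u = 0 -> dt u = a * sin2_dph x u -> dt v = a * sin2_dph x v ->
  kerr M a x u v = - (rho2 a x * dot (sph_part u) (sph_part v)).
Proof.
move=> ex tu tv ru hu hv; have r0 := exterior_pr_gt0 ex; have [_ w1] := ex.
rewrite kerrE // ru hu hv /sin2_dph.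
(* The terms in the product of the two [sin2_dph] have coefficients [a^2 (1 - h)], [2 a^2 h] and
   [- a^2 (1 + h)], which cancel. *)
set h := 2 * M * _ / _; have -> : 2 * M * a * pr x / rho2 a x = a * h.
  by rewrite /h; ring.
by ring.
Qed.

(** The two products differ, up to a positive factor, by the sign of the [dr] term alone, so both of
    their terms vanish. *)
Lemma orthogonal_lnP x u : exterior M a x -> tangent x u ->
  kerr M a x (lvec M a x) u = 0 /\ kerr M a x (nvec M a x) u = 0 <->
  dr u = 0 /\ dt u = a * sin2_dph x u.
Proof.
move=> ex tu; have q0 := rho2_gt0 (exterior_pr_gt0 ex).
have D0 := Delta_r_gt0 ex; rewrite kerr_lvec // kerr_nvec //.
split=> [[h1 /eqP]|[-> ->]]; last by split; ring.
rewrite mulf_eq0 gt_eqF ?divr_gt0 ?mulr_gt0 //= => /eqP h2.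
have : rho2 a x / Delta_r M a x * dr u = 0 by lra.
move=> h3; have /eqP := h3; rewrite mulf_eq0 gt_eqF ?divr_gt0 //= => /eqP ->.
by split=> //; lra.
Qed.

(** Removing the components along [e0] leaves a negative multiple of [det3 w U V], and
    [space_positive] asks for a negative determinant. *)
Lemma space_positive_lnP x u v (k : R) : 0 < k ->
  exterior M a x -> tangent x u -> tangent x v ->
  dr u = 0 -> dr v = 0 -> dt u = a * sin2_dph x u -> dt v = a * sin2_dph x v ->
  let e0 := k *: (lvec M a x + nvec M a x) in
  space_positive x (spatial_part e0 u) (spatial_part e0 (- v))
    (spatial_part e0 (k *: (lvec M a x - nvec M a x))) <->
  0 < det3 (pom x) (sph_part u) (sph_part v).
Proof.
move=> k0 ex; have r0 := exterior_pr_gt0 ex; have q0 := rho2_gt0 r0.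
have D0 := Delta_r_gt0 ex; have [_ w1] := ex.
rewrite /space_positive /spatial_part /tangent /sin2_dph /lvec /nvec.
case: u v => [[ut ur] U] [[vt vr] V].
rewrite /dt /dr /sph_part /= => wU wV -> -> -> ->.
set w := pom x in w1 wU wV *; set q := rho2 a x in q0 *.
set D := Delta_r M a x in D0 *; set A := pr x ^+ 2 + a ^+ 2.
have A0 : 0 < A by rewrite addr_gt0 ?exprn_gt0.
set bU := c1 w * c2 U - _; set bV := c1 w * c2 V - _.
set d := (X in X < 0 <-> _).
have qD0 : 0 < 2 * q + D by rewrite addr_gt0 // mulr_gt0.
(* The [ddph] and [ddt] components of both [l] and [n] are in the ratio [a / A], so removing the
   time component of [k *: (l - n)] along [e0] leaves only a multiple of [w]. *)
have dE : d = - (4 * k * D / (2 * q + D) *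
    (det3 w U V - (a ^+ 2 * bU / A * c3 V - a ^+ 2 * bV / A * c3 U))).
(* Up to sign, [h * bU] and [h * bV] are the radial components brought in by the subtractions along
   [e0]. *)
{ pose h := a * (2 * q - D) * D / ((2 * q + D) * A).
  rewrite -(det3_wedge_w _ (h * bU) _ (h * bV)) // /d.
  have AqD0 : 0 < A * (2 * q) + A * D by rewrite addr_gt0 // !mulr_gt0.
  congr det3; apply: coordP.
  all: rewrite /dt /= ?coordE /h /bU /bV /ddph /GRing.scale /= ?coordE.
  all: by field; rewrite !gt_eqF. }
(* The tilt along [e0] only costs the positive factor [rho^2 / (r^2 + a^2)]. *)
have qA : 1 - a ^+ 2 * (1 - c3 w ^+ 2) / A = q / A.
  have -> : q = A - a ^+ 2 * (1 - c3 w ^+ 2).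
    by rewrite /q /A /rho2 -/w cos_thE; ring.
  by field; rewrite gt_eqF.
have -> : d = - (4 * k * D / (2 * q + D) * (q / A) * det3 w U V).
  rewrite dE -qA; transitivity (- (4 * k * D / (2 * q + D) *
    (det3 w U V - a ^+ 2 / A * (bU * c3 V - bV * c3 U)))); first by ring.
  by rewrite det3_ddph //; ring.
have K0 : 0 < 4 * k * D / (2 * q + D) * (q / A).
  by rewrite mulr_gt0 ?divr_gt0 ?mulr_gt0.
by rewrite oppr_lt0 pmulr_rgt0.
Qed.

Lemma sin2_dphE x u : sin2_dph x u = c3 (cross (pom x) (sph_part u)).
Proof. by rewrite /cross coordE. Qed.

Lemma kerr0l x u : 0 < pr x -> dot (pom x) (pom x) = 1 -> tangent x u ->
  kerr M a x 0 u = 0.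
Proof.
move=> r0 w1 tu; rewrite kerrE //; last exact: tangent0.
by rewrite dotE /dt /dr /sph_part /= !coordE; ring.
Qed.

Lemma kerr_lnZ x k u : exterior M a x -> tangent x u ->
  kerr M a x (k *: (lvec M a x + nvec M a x)) u =
    k * (kerr M a x (lvec M a x) u + kerr M a x (nvec M a x) u) /\
  kerr M a x (k *: (lvec M a x - nvec M a x)) u =
    k * (kerr M a x (lvec M a x) u - kerr M a x (nvec M a x) u).
Proof.
move=> ex tu; have r0 := exterior_pr_gt0 ex; have [_ w1] := ex.
have tl := tangent_lvec x; have tn := tangent_nvec x.
split; first by rewrite scalerDr kerr_linearl //; ring.
by rewrite scalerBr -scaleNr kerr_linearl //; ring.
Qed.

Lemma kerr_ln x : exterior M a x -> kerr M a x (lvec M a x) (nvec M a x) = 1.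
Proof.
move=> ex; have r0 := exterior_pr_gt0 ex; have [_ w1] := ex.
have tl := tangent_lvec x; have tn := tangent_nvec x.
by rewrite -(kerr_nl ex) kerr_sym.
Qed.

(** The vectors [(l + n) / sqrt 2] and [(l - n) / sqrt 2] have squares 1 and -1, and the metric is
    negative definite on the complement of [l] and [n]; a positive determinant makes [u] and [v]
    nonzero there. Only the spatial orientation is left. *)
Lemma oriented_lnP x u v : exterior M a x -> tangent x u -> tangent x v ->
  dr u = 0 -> dr v = 0 -> dt u = a * sin2_dph x u -> dt v = a * sin2_dph x v ->
  oriented_tetrad M a x (lvec M a x) (nvec M a x) (u, v) <->
  0 < det3 (pom x) (sph_part u) (sph_part v).
Proof.
move=> ex tu tv ru rv hu hv.
have r0 := exterior_pr_gt0 ex; have [_ w1] := ex; have q0 := rho2_gt0 r0.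
have tl := tangent_lvec x; have tn := tangent_nvec x.
pose k : R := (Num.sqrt 2)^-1.
have k0 : 0 < k by rewrite invr_gt0 sqrtr_gt0.
have kk : k * k = 2^-1 by rewrite /k -invfM -expr2 sqr_sqrtr.
have tln : tangent x (k *: (lvec M a x + nvec M a x)).
  exact/tangentZ/tangentD.
have tlmn : tangent x (k *: (lvec M a x - nvec M a x)).
  by apply/tangentZ/tangentD => //; rewrite -scaleN1r; exact: tangentZ.
rewrite /oriented_tetrad /oriented_basis -/k /=.
have spP := space_positive_lnP k0 ex tu tv ru rv hu hv.
split=> [[_ _ /spP//]|D0]; split; last exact/spP.
  have Hl := (kerr_lnZ k ex tl).1; have Hn := (kerr_lnZ k ex tn).1.
  rewrite kerr_ll // kerr_nl // in Hl; rewrite kerr_ln // kerr_nn // in Hn.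
  split; [|by rewrite Hl add0r mulr1|by rewrite Hn addr0 mulr1].
  rewrite (kerr_lnZ k ex tln).1 [X in X + _]kerr_sym // Hl.
  by rewrite [kerr _ _ _ (nvec _ _ _) _]kerr_sym // Hn; lra.
have lt0 y : tangent x y -> dr y = 0 -> dt y = a * sin2_dph x y ->
    sph_part y != 0 -> spacelike M a x y.
  move=> ty ry hy y0; rewrite /spacelike kerr_orthogonal // oppr_lt0.
  rewrite mulr_gt0 // lt_def dot_ge0 andbT; apply: contra y0.
  by move=> /eqP/dot_eq0/eqP.
split.
- apply: lt0 => //; apply: contraTneq D0 => ->.
  by rewrite det3E !coordE !(mul0r, mulr0, subr0, addr0) ltxx.
- apply: lt0.
  + by rewrite -scaleN1r; exact: tangentZ.
  + by rewrite /dr /= -/(dr v) rv oppr0.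
  + by rewrite /dt /= -/(dt v) hv /sin2_dph /sph_part /= !coordE; ring.
  + apply: contraTneq D0; rewrite /sph_part /= => /eqP.
    rewrite oppr_eq0 => /eqP ->.
    by rewrite det3E !coordE !(mul0r, mulr0, subr0, addr0) ltxx.
have Hl := (kerr_lnZ k ex tl).2; have Hn := (kerr_lnZ k ex tn).2.
rewrite kerr_ll // kerr_nl // in Hl; rewrite kerr_ln // kerr_nn // in Hn.
rewrite /spacelike (kerr_lnZ k ex tlmn).2 kerr_sym // Hl.
by rewrite [kerr _ _ _ (nvec _ _ _) _]kerr_sym // Hn; lra.

Qed.

(** [U + i (w x U)] completed by the time components that orthogonality to [l] and [n] forces; the
    second one uses [w x (w x U) = - U]. *)
Definition null_vec (w U : 'rV[R]_3) : ctvec R :=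
  ((a * c3 (cross w U), 0, U), (- (a * c3 U), 0, cross w U)).

(** For [m = u + i v], [g(m, m) = 0] makes the spherical parts orthogonal and of equal length,
    [g(m, conj m) = -1] fixes that length, and the orientation lets [crossP] determine the second
    part. *)
Lemma N0r_totalP x m : N0r_total M a (x, m) <->
  exists U, [/\ exterior M a x, dot (pom x) U = 0,
    2 * rho2 a x * dot U U = 1 & m = null_vec (pom x) U].
Proof.
case: m => u v; split.
  move=> [ex [/= tu tv] [/eqP mm /eqP lm /eqP nm] /eqP mbar ori].
  have r0 := exterior_pr_gt0 ex; have [_ w1] := ex; have q0 := rho2_gt0 r0.
  move: lm nm; rewrite !eq_complex /= !kerr0l // !subr0 !addr0.
  move=> /andP[/eqP lu /eqP lv] /andP[/eqP nu /eqP nv].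
  have [ru hu] := (orthogonal_lnP ex tu).1 (conj lu nu).
  have [rv hv] := (orthogonal_lnP ex tv).1 (conj lv nv).
  have tNv : tangent x (- v) by rewrite -scaleN1r; exact: tangentZ.
  have hNv : dt (- v) = a * sin2_dph x (- v).
    by rewrite /dt /= -/(dt v) hv /sin2_dph /sph_part /= !coordE; ring.
  have D0 := (oriented_lnP ex tu tv ru rv hu hv).1 ori.
  move: mm mbar; rewrite !eq_complex /= !kerr_orthogonal //.
  rewrite /sph_part /=; set U := u.2; set V := v.2.
  rewrite /tangent -/U -/V in tu tv.
  have dNr (X Y : 'rV[R]_3) : dot X (- Y) = - dot X Y.
    by rewrite !dotE !coordE; ring.
  have dC : dot V U = dot U V by rewrite !dotE; ring.
  rewrite !dNr dC => /andP[/eqP h1 /eqP h2] /andP[/eqP h3 _].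
  have UV : dot U V = 0.
    by apply: (mulfI (lt0r_neq0 q0)); rewrite mulr0; lra.
  have VU : dot V V = dot U U.
    by apply: (mulfI (lt0r_neq0 q0)); lra.
  have VE : V = cross (pom x) U by apply: crossP.
  exists U; split=> //; first by rewrite VU in h3; lra.
  have tvecE y : y = (dt y, dr y, sph_part y) by case: y => [[]].
  rewrite /null_vec [u]tvecE [v]tvecE hu hv ru rv !sin2_dphE /sph_part -/U -/V VE.
  by rewrite cross_cross tu w1 scale0r scale1r add0r coordN mulrN.
move=> [U [ex wU UU [-> ->]]]; clear u v.
have r0 := exterior_pr_gt0 ex; have [_ w1] := ex; have q0 := rho2_gt0 r0.
set w := pom x in wU w1 *.
set u := (_, _, U); set v := (_, _, cross w U).
have tu : tangent x u by [].
have tv : tangent x v by exact: dot_crossl.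
have ccU : cross w (cross w U) = - U.
  by rewrite cross_cross wU w1 scale0r scale1r add0r.
have hu : dt u = a * sin2_dph x u by rewrite sin2_dphE.
have hv : dt v = a * sin2_dph x v.
  by rewrite sin2_dphE /sph_part /= -/w ccU coordN mulrN.
have tNv : tangent x (- v) by rewrite -scaleN1r; exact: tangentZ.
have rNv : dr (- v) = 0 by rewrite /dr /= oppr0.
have hNv : dt (- v) = a * sin2_dph x (- v).
  rewrite (_ : dt (- v) = - dt v) // hv -mulrN; congr (_ * _).
  by rewrite /sin2_dph /sph_part /= !coordE; ring.
have cUU : dot (cross w U) (cross w U) = dot U U.
  by rewrite dot_cross_cross w1 wU; ring.
have dNr (X Y : 'rV[R]_3) : dot X (- Y) = - dot X Y.
  by rewrite !dotE !coordE; ring.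
have dUc : dot (cross w U) U = 0 by rewrite -(dot_crossr w U) !dotE; ring.
have [lu nu] := (orthogonal_lnP ex tu).2 (conj erefl hu).
have [lv nv] := (orthogonal_lnP ex tv).2 (conj erefl hv).
have U0 : 0 < dot U U.
  by rewrite -(pmulr_rgt0 _ (mulr_gt0 (ltr0Sn R 1) q0)) UU.
split=> //.
- split; apply/eqP; rewrite eq_complex /= ?kerr0l // ?lu ?lv ?nu ?nv.
  + rewrite !kerr_orthogonal // /sph_part /= cUU dot_crossr dUc.
    by rewrite subrr mulr0 oppr0 addr0 !eqxx.
  + by rewrite subrr addr0 !eqxx.
  + by rewrite subrr addr0 !eqxx.
- apply/eqP; rewrite eq_complex /= !kerr_orthogonal // /sph_part /= !dNr.
  rewrite cUU dot_crossr dUc; apply/andP; split; apply/eqP; last by ring.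
  by lra.
- apply/oriented_lnP => //; rewrite det3_cross -/w w1 wU expr0n /= subr0.
  by rewrite mul1r.
Qed.

End Kerr.

(** * The frame map *)

Section FrameMap.
Context {R : realType} (M a : R).
Hypotheses (a_gt0 : 0 < a) (aM : a < M).
Implicit Types (w X Y U : 'rV[R]_3).

(* [re_ip] and [im_ip] are the real and imaginary parts of
   [1 / (sqrt 2 (r + i a cos th))]. *)
Definition re_ip (r : R) w : R :=
  Num.sqrt 2 * r * (2 * (r * r + a * c3 w * (a * c3 w)))^-1.
Definition im_ip (r : R) w : R :=
  - (Num.sqrt 2 * (a * c3 w) * (2 * (r * r + a * c3 w * (a * c3 w)))^-1).

(* Expression of [kerr_frame_map] with scalar real operations only. *)
Definition smooth_frame_map (e : framed R) : (point R * ctvec R)%type :=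
  let r := e.1.2 in let w := e.2.1 in let X := e.2.2.1 in let Y := e.2.2.2 in
  let p := re_ip r w in let q := im_ip r w in
  ((e.1.1, r, w),
   ((a * (p * c3 Y + q * c3 X), 0, p *: X + - (q *: Y)),
    (a * (q * c3 Y + - (p * c3 X)), 0, q *: X + p *: Y))).

(* Multiplication of the spherical part by [sqrt 2 (r + i a cos th)]. *)
Definition frame_map_inv (y : (point R * ctvec R)%type) : framed R :=
  let r := y.1.1.2 in let w := y.1.2 in let U := y.2.1.2 in let V := y.2.2.2 in
  (y.1.1.1, r, (w, (Num.sqrt 2 *: (r *: U + - ((a * c3 w) *: V)),
                    Num.sqrt 2 *: (r *: V + (a * c3 w) *: U)))).

(** * Multiplication by [1 / (sqrt 2 p)] and its inverse *)

Lemma sqrt2_sqr : Num.sqrt 2 * Num.sqrt 2 = 2 :> R.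
Proof. by rewrite -expr2 sqr_sqrtr. Qed.

Lemma ip_den_gt0 (r : R) w : 0 < r -> 0 < r * r + a * c3 w * (a * c3 w).
Proof. by move=> r0; rewrite ltr_wpDr ?mulr_gt0 // -expr2 sqr_ge0. Qed.

(** The complex inverse is the conjugate over the squared modulus, here [2 (r^2 + a^2 cos^2 th)];
    then real and imaginary parts are compared. *)
Lemma kerr_frame_mapE e : 0 < e.1.2 -> kerr_frame_map a e = smooth_frame_map e.
Proof.
case: e => [[t r] [w [X Y]]] /= r0.
have n0 := ip_den_gt0 w r0.
have ipE : ((Num.sqrt 2)%:C * (r +i* (a * cos_th w)))^-1
   = re_ip r w +i* im_ip r w :> R[i].
  apply/eqP; rewrite eq_complex /= cos_thE /re_ip /im_ip mul0r subr0 mul0r addr0.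
  have -> : (Num.sqrt 2 * r) ^+ 2 + (Num.sqrt 2 * (a * c3 w)) ^+ 2 =
      2 * (r * r + a * c3 w * (a * c3 w)).
    by rewrite -[2 in RHS]sqrt2_sqr; ring.
  by rewrite !eqxx.
rewrite /kerr_frame_map ipE /smooth_frame_map /=.
move: (re_ip r w) (im_ip r w) => p q.
rewrite !dotE /e3 !coordE /cscale /ofreal /ddt /tsph /=.
have scE (k x : R) : k *: (x : R^o) = k * x by [].
congr (_, ((_, _, _), (_, _, _)));
  first [by rewrite /= !scE; ring|by apply/rowP => i; rewrite !mxE; ring].
Qed.

(** Gives the normalisation [2 rho^2 |U|^2 = 1] for the image of a unit vector. *)
Lemma ip_norm (r : R) w : 0 < r ->
  2 * (r * r + a * c3 w * (a * c3 w)) * (re_ip r w ^+ 2 + im_ip r w ^+ 2) = 1.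
Proof.
move=> r0; rewrite /re_ip /im_ip.
have := ip_den_gt0 w r0; set n := r * r + _ => n0.
transitivity (Num.sqrt 2 * Num.sqrt 2 * n / (2 * n)).
  by rewrite /n; field; rewrite gt_eqF.
by rewrite sqrt2_sqr divff // gt_eqF // mulr_gt0.
Qed.

(** Real and imaginary parts of [sqrt 2 p] times its inverse, the second one without its factor
    [sqrt 2]. *)
Lemma ip_inv (r : R) w : 0 < r ->
  Num.sqrt 2 * (r * re_ip r w - a * c3 w * im_ip r w) = 1 /\
  r * im_ip r w + a * c3 w * re_ip r w = 0.
Proof.
move=> r0; rewrite /re_ip /im_ip.
have := ip_den_gt0 w r0; set n := r * r + _ => n0.
split; last by ring.
transitivity (Num.sqrt 2 * Num.sqrt 2 * n / (2 * n)).
  by rewrite /n; field; rewrite gt_eqF.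
by rewrite sqrt2_sqr divff // gt_eqF // mulr_gt0.
Qed.

(** As [cross w] squares to -1 on the tangent plane, the form [U + i (w x U)] is stable under
    multiplication by [p + i q]. *)
Lemma crossZD w X (p q : R) : dot w w = 1 -> dot w X = 0 ->
  cross w (p *: X - q *: cross w X) = q *: X + p *: cross w X.
Proof.
move=> w1 wX; transitivity (p *: cross w X - q *: cross w (cross w X)).
  by apply: coordP; rewrite /cross !coordE; ring.
by rewrite cross_cross w1 wX scale0r scale1r add0r scalerN opprK addrC.
Qed.

Lemma dotZD w X (p q : R) : dot w w = 1 -> dot w X = 0 ->
  dot (p *: X - q *: cross w X) (p *: X - q *: cross w X) =
    (p ^+ 2 + q ^+ 2) * dot X X /\
  dot w (p *: X - q *: cross w X) = 0.
Proof.
move=> w1 wX; split.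
  transitivity (p ^+ 2 * dot X X + q ^+ 2 * dot (cross w X) (cross w X)
    - 2 * p * q * dot X (cross w X)); first by rewrite !dotE !coordE; ring.
  by rewrite dot_crossr dot_cross_cross w1 wX; ring.
transitivity (p * dot w X - q * dot w (cross w X)).
  by rewrite !dotE !coordE; ring.
by rewrite wX dot_crossl; ring.
Qed.

Lemma rho2M (x : point R) : rho2 a x =
  pr x * pr x + a * c3 (pom x) * (a * c3 (pom x)).
Proof. by rewrite /rho2 cos_thE; ring. Qed.

Lemma r_horizon_gt0 : 0 < r_horizon M a.
Proof. by rewrite ltr_wpDr ?sqrtr_ge0 // (lt_trans a_gt0). Qed.

(** The time coefficient in the formula of the map is exactly the one that [null_vec] prescribes. *)
Lemma kerr_frame_map_null (t r : R) w X : 0 < r -> dot w w = 1 -> dot w X = 0 ->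
  kerr_frame_map a (t, r, (w, (X, cross w X))) =
  ((t, r, w), null_vec a w (re_ip r w *: X - im_ip r w *: cross w X)).
Proof.
move=> r0 w1 wX; rewrite kerr_frame_mapE // /smooth_frame_map /= /null_vec.
rewrite crossZD // !coordE.
congr (_, ((_, _, _), (_, _, _))); ring.
Qed.

Lemma frame_map_inv_null (t r : R) w U : dot w w = 1 -> dot w U = 0 ->
  let X := (Num.sqrt 2 * r) *: U - (Num.sqrt 2 * (a * c3 w)) *: cross w U in
  frame_map_inv ((t, r, w), null_vec a w U) = (t, r, (w, (X, cross w X))).
Proof.
move=> w1 wU X; rewrite /frame_map_inv /= /X crossZD //.
by congr (_, (_, (_, _))); rewrite scalerDr !scalerA ?scalerN ?scalerA // addrC.
Qed.

Lemma kerr_frame_map_total e : tot_space (frame_bundle M a) e ->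
  tot_space (N0r M a) (kerr_frame_map a e).
Proof.
case: e => [[t r] [w [X Y]]] [rr /frames_S2P[w1 wX X1 ->]].
have r0 := lt_trans r_horizon_gt0 rr.
rewrite kerr_frame_map_null //; apply/(N0r_totalP a_gt0 aM).
have [UU wU] := dotZD (re_ip r w) (im_ip r w) w1 wX.
exists (re_ip r w *: X - im_ip r w *: cross w X); split=> //.
by rewrite UU X1 mulr1 rho2M ip_norm.
Qed.

Lemma frame_map_inv_total y : N0r_total M a y ->
  tot_space (frame_bundle M a) (frame_map_inv y).
Proof.
case: y => x m /(N0r_totalP a_gt0 aM)[U [ex wU UU ->]].
case: x ex wU UU => [[t r] w] [rr w1] wU UU.
rewrite -[pom _]/w in w1 wU *; rewrite frame_map_inv_null //; split=> //.
have [XX wX] := dotZD (Num.sqrt 2 * r) (Num.sqrt 2 * (a * c3 w)) w1 wU.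
apply/frames_S2P; split=> //; rewrite XX -[RHS]UU rho2M /pr /pom /=.
(* The squared modulus of [sqrt 2 p] is [2 rho^2]. *)
by congr (_ * _); rewrite -[2 in RHS]sqrt2_sqr; ring.
Qed.

Lemma frame_map_invK y : N0r_total M a y ->
  kerr_frame_map a (frame_map_inv y) = y.
Proof.
case: y => x m /(N0r_totalP a_gt0 aM)[U [ex wU UU ->]].
have r0 := exterior_pr_gt0 a_gt0 aM ex.
case: x ex wU UU r0 => [[t r] w] [rr w1] wU UU; rewrite -[pr _]/r => r0.
rewrite -[pom _]/w in w1 wU *; rewrite frame_map_inv_null //.
have [_ wX] := dotZD (Num.sqrt 2 * r) (Num.sqrt 2 * (a * c3 w)) w1 wU.
rewrite kerr_frame_map_null //; congr (_, null_vec a w _).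
rewrite crossZD //; have [i1 i0] := ip_inv w r0.
(* The two complex multipliers are collected into their product, which [ip_inv] evaluates to 1. *)
transitivity ((Num.sqrt 2 * (r * re_ip r w - a * c3 w * im_ip r w)) *: U
  - (Num.sqrt 2 * (r * im_ip r w + a * c3 w * re_ip r w)) *: cross w U).
  by apply: coordP; rewrite !coordE; ring.
by rewrite i1 i0 mulr0 scale1r scale0r subr0.
Qed.

Lemma kerr_frame_mapK e : tot_space (frame_bundle M a) e ->
  frame_map_inv (kerr_frame_map a e) = e.
Proof.
case: e => [[t r] [w [X Y]]] [rr /frames_S2P[w1 wX X1 ->]].
have r0 := lt_trans r_horizon_gt0 rr.
rewrite kerr_frame_map_null //.
have [_ wU] := dotZD (re_ip r w) (im_ip r w) w1 wX.
rewrite frame_map_inv_null // crossZD //; have [i1 i0] := ip_inv w r0.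
have -> : (Num.sqrt 2 * r) *: (re_ip r w *: X - im_ip r w *: cross w X) -
  (Num.sqrt 2 * (a * c3 w)) *: (im_ip r w *: X + re_ip r w *: cross w X)
  = X => //.
transitivity ((Num.sqrt 2 * (r * re_ip r w - a * c3 w * im_ip r w)) *: X
  - (Num.sqrt 2 * (r * im_ip r w + a * c3 w * re_ip r w)) *: cross w X).
  by apply: coordP; rewrite !coordE; ring.
by rewrite i1 i0 mulr0 scale1r scale0r subr0.
Qed.

(** [(c X + s Y) + i (- s X + c Y)] is [(c - i s) (X + i Y)], and the map is complex linear in
    [X + i Y]. *)
Lemma kerr_frame_map_act e z : 0 < e.1.2 ->
  kerr_frame_map a (bact (frame_bundle M a) e z) =
  bact (N0r M a) (kerr_frame_map a e) z^*%C.
Proof.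
move=> r0; rewrite (kerr_frame_mapE r0) (@kerr_frame_mapE (bact _ e z)) //.
rewrite /smooth_frame_map.
case: e z r0 => [[t r] [w [X Y]]] [c s] /= _; rewrite /cscale /frame_act /=.
have scE (k x : R) : k *: (x : R^o) = k * x by [].
congr (_, ((_, _, _), (_, _, _)));
  first [by rewrite /= ?coordE ?scE; ring|by apply/rowP => i; rewrite !mxE; ring].
Qed.

(** * Smoothness of the map and of its inverse *)

Lemma open_pos : open [set e : framed R | 0 < e.1.2].
Proof.
apply: (@open_comp _ _ (fun e : framed R => e.1.2) [set x | 0 < x]).
  move=> e _; apply: (@continuous_comp _ _ _ fst snd); [exact: cvg_fst|].
  exact: cvg_snd.
exact: open_gt.
Qed.

Lemma smooth_frame_map_C k :
  class_C k [set e : framed R | 0 < e.1.2] smooth_frame_map.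
Proof.
set O := [set e | _]; have oO : open O by exact: open_pos.
have cid := class_C_id O k.
have cb := class_C_fst oO cid; have cf := class_C_snd oO cid.
have ct := class_C_fst oO cb; have cr := class_C_snd oO cb.
have cw := class_C_fst oO cf; have cXY := class_C_snd oO cf.
have cX := class_C_fst oO cXY; have cY := class_C_snd oO cXY.
have cc := class_C_coord 2%:R oO cw.
have cx := class_C_coord 2%:R oO cX; have cy := class_C_coord 2%:R oO cY.
have ca := class_C_cst O a k.
have cac := class_CM oO ca cc.
have ctwo := class_C_cst O (2 : R) k; have c0 := class_C_cst O (0 : R) k.
have cs := class_C_cst O (Num.sqrt 2 : R) k.
(* The only division: its denominator [2 rho^2] is positive where [r > 0]. *)
have cn := class_CV oO _ (class_CM oO ctwo
  (class_CD oO (class_CM oO cr cr) (class_CM oO cac cac))).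
have {}cn := cn (fun e (He : O e) =>
  lt0r_neq0 (mulr_gt0 (ltr0Sn R 1) (ip_den_gt0 e.2.1 He))).
have cp : class_C k O (fun e => re_ip e.1.2 e.2.1).
  exact: class_CM oO (class_CM oO cs cr) cn.
have cq : class_C k O (fun e => im_ip e.1.2 e.2.1).
  exact: class_CN oO (class_CM oO (class_CM oO cs cac) cn).
apply: (class_C_pair oO); first exact: class_C_pair oO (class_C_pair oO ct cr) cw.
apply: (class_C_pair oO); apply: (class_C_pair oO).
- apply: (class_C_pair oO _ c0); apply: (class_CM oO ca).
  exact: class_CD oO (class_CM oO cp cy) (class_CM oO cq cx).
- exact: class_CD oO (class_CZ oO cp cX) (class_CN oO (class_CZ oO cq cY)).
- apply: (class_C_pair oO _ c0); apply: (class_CM oO ca).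
  exact: class_CD oO (class_CM oO cq cy) (class_CN oO (class_CM oO cp cx)).
- exact: class_CD oO (class_CZ oO cq cX) (class_CZ oO cp cY).
Qed.

(** The components are polynomial, so the whole ambient space serves as domain. *)
Lemma frame_map_inv_C k : class_C k setT frame_map_inv.
Proof.
set O := setT; have oO : open O by exact: openT.
have cid := class_C_id O k.
have cP := class_C_fst oO cid; have cm := class_C_snd oO cid.
have cb := class_C_fst oO cP; have cw := class_C_snd oO cP.
have ct := class_C_fst oO cb; have cr := class_C_snd oO cb.
have cU := class_C_snd oO (class_C_fst oO cm).
have cV := class_C_snd oO (class_C_snd oO cm).
have cac := class_CM oO (class_C_cst O a k) (class_C_coord 2%:R oO cw).
have cs := class_C_cst O (Num.sqrt 2 : R) k.
apply: (class_C_pair oO); first exact: class_C_pair oO ct cr.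
apply: (class_C_pair oO cw); apply: (class_C_pair oO); apply: (class_CZ oO cs).
- exact: class_CD oO (class_CZ oO cr cU) (class_CN oO (class_CZ oO cac cV)).
- exact: class_CD oO (class_CZ oO cr cV) (class_CZ oO cac cU).
Qed.

End FrameMap.

(** * Conjugation on the circle and the bundle isomorphism *)

Lemma U1_automorphism_conj (R : realType) : U1_automorphism (@conjc R).
Proof.
split=> [z w _ _|]; first exact: rmorphM.
(* Conjugation is the restriction of a linear involution of the plane, which is its own smooth
   inverse. *)
pose f (z : R * R) := (z.1, - z.2).
pose circle := [set z : R * R | U1 (z.1 +i* z.2)].
change (diffeomorphism circle circle f).
have fU (z : R * R) : U1 (z.1 +i* z.2) -> U1 ((f z).1 +i* (f z).2).
  by rewrite /U1 /= !normc_def /= sqrrN.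
have fs : smooth_on circle f.
  move=> z _; exists setT, f; split=> [||k|]; [exact: openT|by []| |by []].
  have cid := class_C_id [set: (R * R)%type] k.
  apply: (class_C_pair openT); first exact: class_C_fst openT cid.
  exact: class_CN openT (class_C_snd openT cid).
by split=> //; exists f; split=> // -[z1 z2] _; rewrite /f /= opprK.
Qed.

Theorem proposition3p2 (R : realType) (M a : R) (ha : 0 < a) (haM : a < M) :
  (forall e, tot_space (frame_bundle M a) e ->
     tot_space (N0r M a) (kerr_frame_map a e)) /\
  principal_iso (frame_bundle M a) (N0r M a) (kerr_frame_map a).
Proof.
have total := kerr_frame_map_total ha haM.
have pos e : tot_space (frame_bundle M a) e -> 0 < e.1.2.
  by case=> re _; exact: lt_trans (r_horizon_gt0 ha haM) re.
split=> //; split.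
- split=> //.
    (* One extension serves at all points: the half-space [r > 0] contains the total space because
       the horizon radius is positive. *)
    move=> e He; exists [set e : framed R | 0 < e.1.2], (smooth_frame_map a).
    split=> [||k|y _]; [exact: open_pos|exact: pos|exact: smooth_frame_map_C|].
    exact: kerr_frame_mapE.
  exists (frame_map_inv a); split.
  + exact: frame_map_inv_total.
  + move=> y Hy; exists setT, (frame_map_inv a).
    by split=> [||k|]; [exact: openT|by []|exact: frame_map_inv_C|by []].
  + exact: kerr_frame_mapK.
  + exact: frame_map_invK.
- by case=> [[t r] [w [X Y]]].
(* Rotating a frame multiplies [X + i Y] by the conjugate phase, so conjugation matches the
   structure groups. *)
- exists conjc; first exact: U1_automorphism_conj.
  by move=> e z He _; apply: kerr_frame_map_act; exact: pos.
Qed.
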